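(* Let $E$ and $F$ be nonempty closed convex sets in $\mathbb{R}^n$. The following assertions are equivalent. (a) $E + F = \mathbb{R}^n$ and the metric projections $p_E(u)$ and $p_F(u)$ are orthogonal for every choice of $u \in \mathbb{R}^n$. (b) $E$ and $F$ are convex cones which are polar of each other, i.e. $E = F^\circ$ and $F = E^\circ$.
   Context: $\mathbb{R}^n$ carries the standard dot product $x\cdot y$ and Euclidean norm; $x$ and $y$ are orthogonal if $x\cdot y=0$. $E+F=\{y+z: y\in E, z\in F\}$. For a nonempty closed convex set $E\subseteq\mathbb{R}^n$ and $u\in\mathbb{R}^n$, the metric projection $p_E(u)$ is the unique vector of $E$ nearest to $u$. A nonempty convex set $C$ is a convex cone if $\lambda x\in C$ whenever $\lambda\geqslant 0$ and $x\in C$ (so the origin $o$ belongs to $C$). The (negative) polar set of a nonempty set $X\subseteq\mathbb{R}^n$ is $X^\circ=\{x\in\mathbb{R}^n: x\cdot e\leqslant 0\ \ \forall\, e\in X\}$. Convex cones $C$ and $D$ are polar of each other if $C=D^\circ$ and $D=C^\circ$. *)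

(* Defs.v *)
From HB Require Import structures.
From mathcomp Require Import all_boot all_order all_algebra.
From mathcomp Require Import all_classical all_reals all_analysis.

Set Implicit Arguments.
Unset Strict Implicit.
Unset Printing Implicit Defensive.

Import Order.TTheory GRing.Theory Num.Theory.
Import numFieldNormedType.Exports.

Local Open Scope classical_set_scope.
Local Open Scope ring_scope.

Definition dot (R : realType) (n : nat) (x y : 'rV[R]_n) : R :=
  \sum_(i < n) x ord0 i * y ord0 i.

(* The library norm `|x| on 'rV[R]_n is the sup norm, so it cannot be used for
   nearest points; the topologies (hence [closed]) of the two norms agree. *)
Definition enorm (R : realType) (n : nat) (x : 'rV[R]_n) : R :=
  Num.sqrt (dot x x).

Definition orthogonal_vec (R : realType) (n : nat) (x y : 'rV[R]_n) : Prop :=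
  dot x y = 0.

Definition minkowski_sum (R : realType) (n : nat) (E F : set 'rV[R]_n) :
    set 'rV[R]_n :=
  [set y + z | y in E & z in F].

Definition nearest (R : realType) (n : nat) (E : set 'rV[R]_n)
    (u : 'rV[R]_n) : set 'rV[R]_n :=
  [set y | E y /\ forall z, E z -> enorm (u - y) <= enorm (u - z)].

(* For E nonempty, closed and convex, [nearest E u] is a singleton; the default
   value 0 of [xget] is only taken when u has no nearest point in E. *)
Definition metric_proj (R : realType) (n : nat) (E : set 'rV[R]_n)
    (u : 'rV[R]_n) : 'rV[R]_n :=
  xget 0 (nearest E u).

Definition convex_cone (R : realType) (n : nat) (C : set 'rV[R]_n) : Prop :=
  [/\ C !=set0, @convex_set R 'rV[R]_n C &
      forall (lambda : R) (x : 'rV[R]_n), 0 <= lambda -> C x -> C (lambda *: x)].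

Definition polar (R : realType) (n : nat) (X : set 'rV[R]_n) : set 'rV[R]_n :=
  [set x | forall e, X e -> dot x e <= 0].

Definition mutually_polar (R : realType) (n : nat) (C D : set 'rV[R]_n) : Prop :=
  C = polar D /\ D = polar C.

(* Main.v *)
(** (b) => (a) is Moreau's decomposition: for a closed cone E and p = p_E(u), the
    residual u - p is orthogonal to p, lies in the polar of E and is p_F(u).

    (a) => (b): every point is its own projection and p_E is constant along the
    outward normal rays of E.  Orthogonality along the ray through p_E(0) first
    gives 0 in E and 0 in F.  For x in E, x is orthogonal to p_F(x), and 0 in F
    then forces p_F(x) = 0, that is E is contained in the polar of F.
    Conversely, if u is in the polar of F but not in E, then y = u - p_E(u) is
    nonpositive on F and bounded above on E, contradicting E + F = R^n. *)

Require Import Defs.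
From HB Require Import structures.
From mathcomp Require Import all_boot all_order all_algebra.
From mathcomp Require Import all_classical all_reals all_analysis.
From mathcomp Require Import ring lra.

Set Implicit Arguments.
Unset Strict Implicit.
Unset Printing Implicit Defensive.

Import Order.TTheory GRing.Theory Num.Theory.
Import numFieldNormedType.Exports.

Local Open Scope classical_set_scope.
Local Open Scope ring_scope.

(** * Bilinearity and positivity of the dot product *)

Section DotProduct.
Context {R : realType} {n : nat}.
Implicit Types (x y z : 'rV[R]_n) (E F : set 'rV[R]_n).

Lemma dotC x y : dot x y = dot y x.
Proof. by apply: eq_bigr => i _; rewrite mulrC. Qed.

Lemma dotDl x y z : dot (x + y) z = dot x z + dot y z.
Proof. by rewrite /dot -big_split; apply: eq_bigr => i _; rewrite !mxE mulrDl. Qed.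

Lemma dotZl (a : R) x y : dot (a *: x) y = a * dot x y.
Proof. by rewrite /dot mulr_sumr; apply: eq_bigr => i _; rewrite !mxE mulrA. Qed.

Lemma dotNl x y : dot (- x) y = - dot x y.
Proof. by rewrite -scaleN1r dotZl mulN1r. Qed.

Lemma dot0l x : dot 0 x = 0.
Proof. by rewrite -(scale0r 0) dotZl mul0r. Qed.

Lemma dotDr x y z : dot z (x + y) = dot z x + dot z y.
Proof. by rewrite dotC dotDl !(dotC z). Qed.

Lemma dotZr (a : R) x y : dot y (a *: x) = a * dot y x.
Proof. by rewrite dotC dotZl (dotC y). Qed.

Lemma dotNr x y : dot y (- x) = - dot y x.
Proof. by rewrite dotC dotNl (dotC y). Qed.

Lemma dot0r x : dot x 0 = 0.
Proof. by rewrite dotC dot0l. Qed.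

Definition dotE := (dotDl, dotDr, dotNl, dotNr, dotZl, dotZr, dot0l, dot0r).

Lemma dot_ge0 x : 0 <= dot x x.
Proof. by apply: sumr_ge0 => i _; rewrite -expr2 sqr_ge0. Qed.

Lemma dot_le0 x : dot x x <= 0 -> x = 0.
Proof.
move=> x0; have /eqP : dot x x = 0 by apply/le_anti; rewrite x0 dot_ge0.
rewrite psumr_eq0; last by move=> i _; rewrite -expr2 sqr_ge0.
move=> /allP xx; apply/rowP => i; rewrite mxE; apply/eqP.
by have := xx i (mem_index_enum _); rewrite /= mulf_eq0 orbb.
Qed.

Lemma dot_subZ x y (t : R) :
  dot (x - t *: y) (x - t *: y) = dot x x - 2 * t * dot x y + t ^+ 2 * dot y y.
Proof. by rewrite !dotE (dotC y x); ring. Qed.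

Lemma enorm_le x y : (enorm x <= enorm y) = (dot x x <= dot y y).
Proof. by rewrite /enorm ler_sqrt // dot_ge0. Qed.

Lemma sqr_coord_le_dot x i : x ord0 i ^+ 2 <= dot x x.
Proof.
rewrite /dot (bigD1 i)//= -expr2 lerDl.
by apply: sumr_ge0 => j _; rewrite -expr2 sqr_ge0.
Qed.

(** * Nearest points: existence, variational inequality, uniqueness *)

Lemma continuous_sqdist (u : 'rV[R]_n) :
  continuous (fun z : 'rV[R]_n => dot (u - z) (u - z)).
Proof.
rewrite (_ : (fun z => _) = (fun z =>
    \sum_(i < n) (u ord0 i - z ord0 i) * (u ord0 i - z ord0 i))); last first.
  by apply/funext => z; apply: eq_bigr => i _; rewrite !mxE.
apply: continuous_big => [|i _ z]; first exact: add_continuous.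
have cz : {for z, continuous (fun z : 'rV[R]_n => u ord0 i - z ord0 i)}.
  by apply: continuousB; [exact: cst_continuous|exact: coord_continuous].
exact: (continuousM cz cz).
Qed.

(** Cutting [E] by the ball around [u] through a point [e] of [E] leaves a compact set, on which the
    squared distance attains its minimum. *)
Lemma nearest_exists E u : E !=set0 -> closed E -> nearest E u !=set0.
Proof.
move=> [e Ee] Ecl; pose f z := dot (u - z) (u - z).
pose A := E `&` [set z | f z <= f e].
have Acl : closed A.
  apply: closedI => //; apply: (@closed_comp _ _ f [set r | r <= f e]).
    by move=> z _; exact: continuous_sqdist.
  exact: closed_le.
have Ac : compact A.
  (* A real [s] with [s ^+ 2 <= f e] satisfies [|s| <= f e + 1], so this box contains [A] and no
     square root is needed. *)
  have Bc := @rV_compact R n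
    (fun i => `[u ord0 i - (f e + 1), u ord0 i + (f e + 1)]%classic)
    (fun=> @segment_compact _ _ _).
  apply: subclosed_compact Acl Bc _ => z [_ /= fz] i /=.
  have := sqr_coord_le_dot (u - z) i; rewrite !mxE in_itv /= -/(f z) => zi.
  have := dot_ge0 (u - e); rewrite -/(f e) => fe; apply/andP; split; nra.
have A0 : A !=set0 by exists e; split => /=.
have cf : {within A, continuous f}.
  by apply: continuous_subspaceT; exact: continuous_sqdist.
have [c Ac' cmin] := EVT_min_rV A0 Ac cf.
move: Ac'; rewrite inE => -[Ec fc]; exists c; split => // z Ez.
rewrite enorm_le -/(f _) -/(f _); have [zl|/ltW zg] := leP (f z) (f e).
  by apply: cmin; rewrite inE.
exact: le_trans zg.
Qed.

Lemma le0_of_bounded_multiples (a c : R) :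
  (forall t, 0 <= t -> t * a <= c) -> a <= 0.
Proof.
move=> H; have c0 := H 0 (lexx 0); rewrite mul0r in c0.
rewrite leNgt; apply/negP => a0.
have /H : 0 <= (c + 1) / a by rewrite divr_ge0 ?addr_ge0 // ltW.
by rewrite divfK ?gt_eqF //; lra.
Qed.

Lemma convex_setP E : @convex_set R 'rV[R]_n E ->
  forall x y (t : R), 0 <= t <= 1 -> E x -> E y -> E (x + t *: (y - x)).
Proof.
move=> cE x y t t01 Ex Ey.
have : (y : convex_lmodType 'rV[R]_n) \in E by rewrite inE.
move=> /cE; have : (x : convex_lmodType 'rV[R]_n) \in E by rewrite inE.
move=> xE /(_ _ (Itv01 (proj1 (andP t01)) (proj2 (andP t01))) xE); rewrite inE.
by congr E; rewrite /conv/= /unstable.onem scalerBl scale1r scalerBr addrC addrA addrAC.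
Qed.

(** For the direct implication, [p] is compared with the points [p + t *: (z - p)] of the segment to
    [z]: for small [t] the linear term of the squared distance dominates. *)
Lemma nearestP E u p : @convex_set R 'rV[R]_n E ->
  nearest E u p <-> E p /\ forall z, E z -> dot (u - p) (z - p) <= 0.
Proof.
move=> cE; split=> -[Ep pE]; split => // z Ez; last first.
  rewrite enorm_le; have := pE z Ez; have := dot_ge0 (p - z).
  by rewrite !dotE (dotC z) (dotC p u) (dotC p z) (dotC z u); lra.
set d := dot _ _; set q := dot (z - p) (z - p).
have q0 : 0 <= q by exact: dot_ge0.
have H t : 0 <= t <= 1 -> 2 * t * d <= t ^+ 2 * q.
  move=> t01; have := pE _ (convex_setP cE t01 Ep Ez); rewrite enorm_le.
  have -> : u - (p + t *: (z - p)) = (u - p) - t *: (z - p) by rewrite opprD addrA.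
  by rewrite dot_subZ -/d -/q; lra.
rewrite leNgt; apply/negP => d0.
have qd : 0 < q + d by lra.
(* This [t] lies in [0, 1] even when [q = 0], and [t * q < 2 * d] contradicts [H]. *)
have /H : 0 <= d / (q + d) <= 1.
  apply/andP; split; first by rewrite divr_ge0 // ltW.
  by rewrite ler_pdivrMr // mul1r lerDr.
move=> Hd; have : 2 * d <= d / (q + d) * q.
  have t0 : 0 < d / (q + d) by rewrite divr_gt0.
  by rewrite -(ler_pM2l t0); move: Hd; rewrite expr2; lra.
by rewrite -mulrA (mulrC 2) ler_pM2l // ler_pdivlMl //; lra.
Qed.

Lemma metric_projP E u : E !=set0 -> closed E -> @convex_set R 'rV[R]_n E ->
  E (metric_proj E u) /\
  forall z, E z -> dot (u - metric_proj E u) (z - metric_proj E u) <= 0.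
Proof.
move=> E0 Ecl cE; apply/(nearestP _ _ cE); apply: xgetPex.
exact: nearest_exists.
Qed.

Lemma metric_proj_eq E u p : @convex_set R 'rV[R]_n E -> E p ->
  (forall z, E z -> dot (u - p) (z - p) <= 0) -> metric_proj E u = p.
Proof.
move=> cE Ep pE.
have /(xgetPex 0)/(nearestP _ _ cE) : nearest E u !=set0.
  by exists p; apply/nearestP.
rewrite -/(metric_proj E u) => -[Eq qE].
(* The inequality at [p] tested on [q] and the one at [q] tested on [p] add up to
   [|p - q|^2 <= 0]. *)
apply/eqP; rewrite -subr_eq0; apply/eqP/dot_le0.
have := pE _ Eq; have := qE _ Ep.
set q := metric_proj E u; rewrite !dotE (dotC p q); lra.
Qed.

(** * Polar cones and Moreau's decomposition *)

Lemma polar_convex_cone E : convex_cone (polar E).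
Proof.
split.
- by exists 0 => e _; rewrite dot0l.
- move=> x y t; rewrite !inE => Ex Ey e Ee.
  rewrite /conv/= dotDl !dotZl.
  rewrite -[leRHS]addr0; apply: lerD; rewrite mulr_ge0_le0 ?unstable.onem_ge0 //.
    exact: Ex.
  exact: Ey.
- by move=> t x t0 Ex e Ee; rewrite dotZl mulr_ge0_le0 // Ex.
Qed.

Lemma convex_cone_add E x y : convex_cone E -> E x -> E y -> E (x + y).
Proof.
move=> [_ cE Ez] Ex Ey.
have -> : x + y = 2 *: (x + 2^-1 *: (y - x)).
  rewrite scalerDr scalerA divff ?pnatr_eq0 // scale1r scaler_nat mulr2n -addrA.
  by rewrite [x + (y - x)]addrCA subrr addr0.
by apply: Ez => //; apply: convex_setP => //; lra.
Qed.

(** The variational inequality at [p] is tested on [0] and [2 *: p] for orthogonality, and on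
    [p + e] for polarity. *)
Lemma metric_proj_cone E u : convex_cone E -> closed E ->
  [/\ E (metric_proj E u), dot (u - metric_proj E u) (metric_proj E u) = 0 &
      polar E (u - metric_proj E u)].
Proof.
move=> Econe Ecl; have [E0 cE Ez] := Econe.
have [] := metric_projP u E0 Ecl cE; set p := metric_proj E u => Ep pE.
split => //.
  apply/le_anti; have := pE _ (Ez 0 p (lexx 0) Ep); have := pE _ (Ez 2 p (ler0n _ 2) Ep).
  by rewrite scale0r scaler_nat mulr2n addrK sub0r dotNr; lra.
by move=> e Ee; have := pE _ (convex_cone_add Econe Ep Ee); rewrite addrAC subrr add0r.
Qed.

End DotProduct.

(** * Consequences of a full sum and orthogonal projections *)

Section OrthogonalProjections.
Context {R : realType} {n : nat} (E F : set 'rV[R]_n).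
Context (E_neq0 : E !=set0) (E_closed : closed E)
  (E_convex : @convex_set R 'rV[R]_n E).
Context (F_neq0 : F !=set0) (F_closed : closed F)
  (F_convex : @convex_set R 'rV[R]_n F).
Context (EF_sum : minkowski_sum E F = [set: 'rV[R]_n])
  (EF_orth : forall u, dot (metric_proj E u) (metric_proj F u) = 0).

Let sumP u : exists e f, [/\ E e, F f & u = e + f].
Proof.
have : minkowski_sum E F u by rewrite EF_sum.
by case=> e Ee [f Ff <-]; exists e, f.
Qed.

(* If e = p_E(0) <> 0 then p_E(-t e) = e for all t >= 0, so the points p_F(-t e)
   all lie in the hyperplane orthogonal to e and hence coincide; letting t go to
   infinity shows that F, like E, lies in the half-space {x | 0 <= e . x}. *)
Lemma orthogonal_proj_mem0 : E 0.
Proof.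
have [] := metric_projP 0 E_neq0 E_closed E_convex.
set e := metric_proj E 0 => Ee eE.
have Pt t : 0 <= t -> metric_proj E (- t *: e) = e.
  move=> t0; apply: metric_proj_eq => // z /eE.
  have -> : - t *: e - e = (1 + t) *: (0 - e).
    by rewrite sub0r scalerN scalerDl scale1r opprD scaleNr addrC.
  by rewrite dotZl => ez; rewrite mulr_ge0_le0 // addr_ge0.
have [] := metric_projP 0 F_neq0 F_closed F_convex.
have := EF_orth 0; rewrite -/e; set q := metric_proj F 0 => eq Fq qF.
have Qt t : 0 <= t -> metric_proj F (- t *: e) = q.
  move=> t0; have [] := metric_projP (- t *: e) F_neq0 F_closed F_convex.
  have := EF_orth (- t *: e); rewrite Pt //; set r := metric_proj F _ => er Fr rF.
  apply/eqP; rewrite -subr_eq0; apply/eqP/dot_le0.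
  have := qF _ Fr; have := rF _ Fq; rewrite !dotE eq er (dotC q r); lra.
have eF f : F f -> 0 <= dot e f.
  move=> Ff; rewrite -oppr_le0;
  apply: (le0_of_bounded_multiples (c := dot q f - dot q q)).
  move=> t t0; have [_] := metric_projP (- t *: e) F_neq0 F_closed F_convex.
  by rewrite Qt // => /(_ _ Ff); rewrite !dotE eq; lra.
suff -> : 0 = e by [].
(* Here [dot e a >= dot e e] and [dot e b >= 0], while their sum is [- dot e e]. *)
apply/esym/dot_le0; have [a [b [Ea Fb eab]]] := sumP (- e).
have := eE _ Ea; have := eF _ Fb; have := congr1 (dot e) eab; rewrite !dotE; lra.
Qed.

Lemma orthogonal_proj_sub_polar : F 0 -> E `<=` polar F.
Proof.
move=> F0 x Ex f Ff.
have Px : metric_proj E x = x.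
  by apply: metric_proj_eq => // z _; rewrite subrr dot0l.
have [] := metric_projP x F_neq0 F_closed F_convex.
have := EF_orth x; rewrite Px; set q := metric_proj F x => xq Fq qF.
have q0 : q = 0 by apply: dot_le0; have := qF _ F0; rewrite !dotE xq; lra.
by have := qF _ Ff; rewrite q0 !subr0.
Qed.

(* With x = p_E(u) and y = u - x, orthogonality on the normal ray x + t y, t >= 0,
   forces p_F(x + t y) = 0, so the whole ray is in the polar of F, hence so is y. *)
Lemma polar_sub_orthogonal_proj : F 0 -> polar F `<=` E.
Proof.
move=> F0 u uF; have [] := metric_projP u E_neq0 E_closed E_convex.
set x := metric_proj E u; set y := u - x => Ex xE.
have Pt t : 0 <= t -> metric_proj E (x + t *: y) = x.
  move=> t0; apply: metric_proj_eq => // z /xE xz.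
  by rewrite addrAC subrr add0r dotZl mulr_ge0_le0.
have Qt t : 0 <= t -> metric_proj F (x + t *: y) = 0.
  move=> t0; have [] := metric_projP (x + t *: y) F_neq0 F_closed F_convex.
  have := EF_orth (x + t *: y); rewrite Pt //; set q := metric_proj F _ => xq Fq qF.
  (* Testing [q] against [0] gives [dot q q <= t * dot y q], and [dot y q = dot u q] because [x] is
     orthogonal to [q]. *)
  have uq : t * dot u q <= 0 by rewrite mulr_ge0_le0 // uF.
  apply: dot_le0; have := qF _ F0; rewrite /y !dotE xq; lra.
have yF f : F f -> dot y f <= 0.
  move=> Ff; apply: (le0_of_bounded_multiples (c := - dot x f)) => t t0.
  have [_] := metric_projP (x + t *: y) F_neq0 F_closed F_convex.
  by rewrite Qt // => /(_ _ Ff); rewrite !subr0 dotDl dotZl; lra.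
suff /eqP : y = 0 by rewrite subr_eq0 => /eqP ->.
(* On [E] the form [dot y] is at most [dot y x], on [F] at most 0; splitting [t *: y] over [E + F]
   bounds [t * dot y y]. *)
apply: dot_le0; apply: (le0_of_bounded_multiples (c := dot y x)) => t t0.
have [e [f [Ee Ff ef]]] := sumP (t *: y).
have := xE _ Ee; have := yF _ Ff; have := congr1 (dot y) ef; rewrite !dotE; lra.
Qed.

End OrthogonalProjections.

(** * Symmetry in the two sets and the equivalence *)

Lemma minkowski_sumC (R : realType) (n : nat) (E F : set 'rV[R]_n) :
  minkowski_sum E F = minkowski_sum F E.
Proof.
by apply/seteqP; split=> _ [x xE [y yE <-]];
  exists y => //; exists x => //; rewrite addrC.
Qed.

Theorem theorem1p3 (R : realType) (n : nat) (E F : set 'rV[R]_n)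
    (E_neq0 : E !=set0) (E_closed : closed E)
    (E_convex : @convex_set R 'rV[R]_n E)
    (F_neq0 : F !=set0) (F_closed : closed F)
    (F_convex : @convex_set R 'rV[R]_n F) :
  (minkowski_sum E F = [set: 'rV[R]_n] /\
   forall u : 'rV[R]_n, orthogonal_vec (metric_proj E u) (metric_proj F u))
  <->
  [/\ convex_cone E, convex_cone F & mutually_polar E F].
Proof.
split=> [[EF orth]|[Econe Fcone [EF FE]]].
  have FE := EF; rewrite minkowski_sumC in FE.
  have orth' u : dot (metric_proj F u) (metric_proj E u) = 0 by rewrite dotC orth.
  have E0 : E 0 by apply: (@orthogonal_proj_mem0 _ _ E F).
  have F0 : F 0 by apply: (@orthogonal_proj_mem0 _ _ F E).
  have EpF : E = polar F.
    apply/seteqP; split; first exact: orthogonal_proj_sub_polar.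
    exact: polar_sub_orthogonal_proj.
  have FpE : F = polar E.
    apply/seteqP; split; first exact: orthogonal_proj_sub_polar.
    exact: polar_sub_orthogonal_proj.
  split; [rewrite EpF|rewrite FpE|by []]; exact: polar_convex_cone.
split=> [|u].
  apply/seteqP; split => // u _.
  have [Ep _ uE] := metric_proj_cone u Econe E_closed.
  by exists (metric_proj E u) => //;
    exists (u - metric_proj E u); rewrite ?FE // addrC subrK.
have [] := metric_proj_cone u Econe E_closed.
set p := metric_proj E u => Ep up; rewrite -FE => Fup.
rewrite /orthogonal_vec (_ : metric_proj F u = u - p) ?(dotC p) //.
(* The residual of [u - p] is [p], orthogonal to [u - p], so the inequality reduces to [p] being in
   [polar F]. *)
apply: metric_proj_eq => // z Fz; rewrite subKr dotDr dotNr (dotC p (u - p)) up subr0.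
by rewrite EF in Ep; exact: Ep.
Qed.
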